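(* Let $\lambda>0$, let $f:[0,\infty)\to[0,\infty)$ be locally Lipschitz continuous and superlinear and subcritical at infinity (as specified in the context), let $\mathcal{T}_h$ be the grid on the $N$-rectangle $\overline{\Omega}$ described in the context, and let $\rho,K>0$ with $\rho<\frac{K}{h^*}$. Let $\widetilde f$ be the truncation of $f$ defined in the context. Then there exists a nonnegative grid function $\widetilde u_h:\mathcal{T}_h\to\mathbb{R}$ such that $$-\Delta_h \widetilde u_h+\widetilde u_h=0 \quad\text{in } \mathcal{T}_h\cap\Omega,\qquad \nabla_h^*\widetilde u_h\cdot\widehat n-\lambda\widetilde f(\widetilde u_h)=0\quad\text{on }\mathcal{T}_h\cap\widetilde{\partial\Omega}.$$
   Context: Domain and grid: $\Omega=(a_1,b_1)\times\cdots\times(a_N,b_N)\subset\mathbb{R}^N$ is an $N$-rectangle; for $i=1,\dots,N$, $m_i\ge 4$ is an integer and $h_i=\frac{b_i-a_i}{m_i-1}$. For each multi-index $\alpha=(\alpha_1,\dots,\alpha_N)$ with $1\le\alpha_i\le m_i$, set $x_\alpha=(a_1+(\alpha_1-1)h_1,\dots,a_N+(\alpha_N-1)h_N)$; $\mathcal{T}_h$ is the set of all these points. A grid function is a map $\mathcal{T}_h\to\mathbb{R}$. Put $h^*=\max_i h_i$, $h_*=\min_i h_i$, and let $e_i$ be the canonical basis vectors. $\widetilde{\partial\Omega}$ is $\partial\Omega$ with the points where $\partial\Omega$ is not smooth removed (so each point of $\widetilde{\partial\Omega}$ lies in the relative interior of exactly one face), and $\widehat n$ is the unit outward normal vector. Discrete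 operators: for a grid function $u_h$ and $x_\alpha\in\mathcal{T}_h\cap\Omega$, $$\Delta_h u_h(x_\alpha)=\sum_{i=1}^N\frac{u_h(x_{\alpha+e_i})-2u_h(x_\alpha)+u_h(x_{\alpha-e_i})}{h_i^2}.$$ For $x_\alpha\in\mathcal{T}_h\cap\widetilde{\partial\Omega}$, $\nabla_h^*u_h(x_\alpha)$ has $i$-th component $\frac{u_h(x_{\alpha+e_i})-u_h(x_\alpha)}{h_i}$ if $\widehat n_i(x_\alpha)<0$, $\frac{u_h(x_\alpha)-u_h(x_{\alpha-e_i})}{h_i}$ if $\widehat n_i(x_\alpha)>0$, and $\frac{u_h(x_{\alpha+e_i})-u_h(x_{\alpha-e_i})}{2h_i}$ if $\widehat n_i(x_\alpha)=0$. Thus $\nabla_h^*u_h(x_\alpha)\cdot\widehat n=\frac{u_h(x_\alpha)-u_h(y)}{h_i}$, where $i$ is the direction normal to the face containing $x_\alpha$ and $y\in\mathcal{T}_h\cap\Omega$ is the adjacent grid point in the inward normal direction. Standing assumption on $f$: there are $b>0$ and $p$ with $\lim_{s\to+\infty}\frac{f(s)}{s^p}=b$, where $1<p<\frac{N}{N-2}$ if $N\ge 3$ and $p>1$ if $N\in\{1,2\}$. Truncation: $\widetilde f:[0,\infty)\to\left[\frac{\rho}{\lambda},\frac{K}{\lambda h^*}\right]$ is defined by $\widetilde f(s)=\frac{K}{\lambda h^*}$ if $f(s)>\frac{K}{\lambda h^*}$, $\widetilde f(s)=\frac{\rho}{\lambda}$ if $f(s)<\frac{\rho}{\lambda}$,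 and $\widetilde f(s)=f(s)$ otherwise. *)

(* Defs.v *)
(* MathComp-Analysis, over an arbitrary R : realType. *)
From HB Require Import structures.
From mathcomp Require Import all_boot all_order all_algebra.
From mathcomp Require Import all_classical all_reals all_analysis.
Set Implicit Arguments.
Unset Strict Implicit.
Unset Printing Implicit Defensive.
Import Order.TTheory GRing.Theory Num.Theory.
Import numFieldNormedType.Exports.
Local Open Scope classical_set_scope.
Local Open Scope ring_scope.

Definition rectangle (R : realType) (N : nat) (a b : 'rV[R]_N) : set 'rV[R]_N :=
  [set x | forall i, a 0 i < x 0 i < b 0 i].

Definition boundary (T : topologicalType) (A : set T) : set T :=
  closure A `\` interior A.

(* The boundary of a rectangle is not smooth exactly at the points that lie on
   several of the hyperplanes x_i = a_i, x_i = b_i; a boundary point lying on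
   only one of them is in the relative interior of a face. *)
Definition smooth_boundary (R : realType) (N : nat) (a b : 'rV[R]_N) :
    set 'rV[R]_N :=
  [set x | boundary (rectangle a b) x /\
           exists! i, x 0 i = a 0 i \/ x 0 i = b 0 i].

(* Only meaningful at points of [smooth_boundary a b], where exactly one
   component is nonzero. *)
Definition outward_normal (R : realType) (N : nat) (a b x : 'rV[R]_N) : 'rV[R]_N :=
  \row_i (if x 0 i == a 0 i then -1 else if x 0 i == b 0 i then 1 else 0).

Definition mesh (R : realType) (N : nat) (a b : 'rV[R]_N) (m : 'I_N -> nat)
    (i : 'I_N) : R :=
  (b 0 i - a 0 i) / ((m i)%:R - 1).

Definition mesh_max (R : realType) (N : nat) (a b : 'rV[R]_N)
    (m : 'I_N -> nat) : R :=
  \big[Num.max/0]_(i < N) mesh a b m i.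

(* Multi-indices are 0-based: component i ranges over 0, ..., m_i - 1. *)
Definition multi_index (N : nat) (m : 'I_N -> nat) : finType :=
  {dffun forall i : 'I_N, 'I_(m i)}.

Definition grid_point (R : realType) (N : nat) (a b : 'rV[R]_N)
    (m : 'I_N -> nat) (alpha : multi_index m) : 'rV[R]_N :=
  \row_i (a 0 i + (alpha i)%:R * mesh a b m i).

(* alpha |-> grid_point a b alpha is injective when a < b componentwise, so maps
   from the set of grid points to R are the same as maps from multi-indices. *)
Definition grid_function (R : realType) (N : nat) (m : 'I_N -> nat) : Type :=
  multi_index m -> R.

(* alpha + e_i and alpha - e_i; alpha itself when the neighbour would be outside
   the grid, a case that never matters below: neighbours in direction i are
   taken at interior points, at smooth boundary points whose face is parallel
   to e_i, or inwards. *)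
Definition next_index (N : nat) (m : 'I_N -> nat) (i : 'I_N) (alpha : multi_index m) :
    multi_index m :=
  [ffun j : 'I_N => if j == i then insubd (alpha j) (alpha j).+1 else alpha j].

Definition prev_index (N : nat) (m : 'I_N -> nat) (i : 'I_N) (alpha : multi_index m) :
    multi_index m :=
  [ffun j : 'I_N => if j == i then insubd (alpha j) (alpha j).-1 else alpha j].

Definition discrete_laplacian (R : realType) (N : nat) (a b : 'rV[R]_N)
    (m : 'I_N -> nat) (u : grid_function R m) (alpha : multi_index m) : R :=
  \sum_(i < N)
    (u (next_index i alpha) - 2 * u alpha + u (prev_index i alpha)) / mesh a b m i ^+ 2.

Definition discrete_gradient (R : realType) (N : nat) (a b : 'rV[R]_N)
    (m : 'I_N -> nat) (u : grid_function R m) (alpha : multi_index m) :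
    'rV[R]_N :=
  \row_i
    let h := mesh a b m i in
    let n := outward_normal a b (grid_point a b alpha) 0 i in
    if n < 0 then (u (next_index i alpha) - u alpha) / h
    else if 0 < n then (u alpha - u (prev_index i alpha)) / h
    else (u (next_index i alpha) - u (prev_index i alpha)) / (2 * h).

Definition dot (R : realType) (N : nat) (x y : 'rV[R]_N) : R :=
  \sum_(i < N) x 0 i * y 0 i.

Definition superlinear_subcritical (R : realType) (N : nat) (f : R -> R) : Prop :=
  exists c p : R,
    [/\ 0 < c, 1 < p, (3 <= N)%N -> p < N%:R / (N%:R - 2) &
        f s / s `^ p @[s --> +oo] --> c].

Definition truncation (R : realType) (lambda rho K hmax : R) (f : R -> R)
    (s : R) : R :=
  if K / (lambda * hmax) < f s then K / (lambda * hmax)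
  else if f s < rho / lambda then rho / lambda
  else f s.

(* Main.v *)
Require Import Defs.
From HB Require Import structures.
From mathcomp Require Import all_boot all_order all_algebra.
From mathcomp Require Import all_classical all_reals all_analysis.
From mathcomp Require Import lra.
Set Implicit Arguments.
Unset Strict Implicit.
Unset Printing Implicit Defensive.
Import Order.TTheory GRing.Theory Num.Theory.
Import numFieldNormedType.Exports.
Local Open Scope classical_set_scope.
Local Open Scope ring_scope.
(** The discrete problem is solved by Perron's method. At each grid point [al]
move everything to one side, so that the unknown [u] must satisfy
[residual q al u = 0], where [residual q al u] is the discrete Laplacian minus
[u] inside the rectangle and [q (u al)] minus the normal derivative elsewhere,
with [q = lambda * truncation]. The coefficients of the neighbours of [al] in
this expression are nonnegative, so [residual q al u] is nondecreasing in every
value of [u] other than [u al] (a quasi-monotone system), and it is continuous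
in [u al]. For such systems the pointwise supremum [u] of the subsolutions
between an ordered sub- and supersolution is an exact solution
([quasi_monotone_solution]): [u] is itself a subsolution, and where its residual
is positive it could be raised a little.

The zero function is a subsolution because the truncation is bounded below by
[rho / lambda > 0] ([residual_zero_ge0]). The supersolution is explicit: because
the truncation is bounded above, [lambda * truncation <= K / hmax], a jump of
height [K] across each face gives a normal derivative at least [K / h_i >=
K / hmax], and adding the constant [sum_i 2 K / h_i ^ 2] absorbs the Laplacian
which this jump creates next to the boundary ([barrier_residual_le0]).

The function [f] enters only for nonnegative arguments; composing with [max 0]
makes the nonlinearity continuous on the whole line, and since the solution is
nonnegative this changes nothing. *)

(** * Perron's method for quasi-monotone systems *)

Section Perron.
Context {R : realType} {I : eqType}.
Implicit Types (u v : I -> R) (F : I -> (I -> R) -> R).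

Definition quasi_monotone F := forall i u v,
  (forall j, u j <= v j) -> u i = v i -> F i u <= F i v.

Definition own_continuous F := forall i u,
  continuous (fun t => F i (dfwith u i t)).

Lemma dfwith_id u i : dfwith u i (u i) = u.
Proof. by apply/funext => j; case: dfwithP. Qed.

(** The solution is the supremum [u] of all subsolutions between [lo] and [hi].
Replacing [u i] by the value [v i] of a subsolution [v] gives, by
quasi-monotonicity, an [i]-th residual at least [F i v >= 0]; letting [v i] tend
to [u i] shows that [u] is a subsolution. If [F i u > 0], then [u i < hi i], and a
slightly larger [i]-th value still gives a subsolution, because the other
residuals can only grow; this contradicts the choice of [u]. *)
Lemma quasi_monotone_solution F (lo hi : I -> R) :
  quasi_monotone F -> own_continuous F ->
  (forall i, lo i <= hi i) ->
  (forall i, 0 <= F i lo) -> (forall i, F i hi <= 0) ->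
  exists u, (forall i, lo i <= u i <= hi i) /\ forall i, F i u = 0.
Proof.
move=> Fmono Fcont lohi Flo Fhi.
pose S := [set v | (forall i, lo i <= v i <= hi i) /\ forall i, 0 <= F i v].
pose E i := [set v i | v in S].
pose u i := sup (E i).
have Slo : S lo by split=> // i; rewrite lexx lohi.
have ubE i : ubound (E i) (hi i) by move=> _ [v [+ _] <-] => /(_ i)/andP[].
have Eub i : has_ubound (E i) by exists (hi i); exact: ubE.
have Esup i : has_sup (E i) by split; [exists (lo i), lo|].
have leu v : S v -> forall i, v i <= u i.
  by move=> Sv i; apply: ub_le_sup => //; exists v.
have ubnd i : lo i <= u i <= hi i.
  by rewrite leu//=; apply: ge_sup (ubE i); exists (lo i), lo.
have Fu i : 0 <= F i u.
  rewrite leNgt; apply/negP => Fu_lt0.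
  have : \forall t \near u i, F i (dfwith u i t) < 0.
    by apply: cvgr_lt (Fcont i u (u i)) _ _; rewrite dfwith_id.
  move=> /nbhs_ballP[e /= e0 neg].
  have [_ [v Sv <-] vi] := sup_adherent e0 (Esup i).
  have vu := leu v Sv i.
  have : F i (dfwith u i (v i)) < 0.
    apply: neg; rewrite /ball/= ger0_norm ?subr_ge0//.
    by move: vi; rewrite -/(u i); lra.
  apply/negP; rewrite -leNgt; apply: le_trans (Sv.2 i) _.
  apply: Fmono => [j|]; last by rewrite dfwithin.
  by case: dfwithP => // *; exact: leu.
exists u; split=> // i; apply/eqP; rewrite eq_le Fu andbT leNgt.
apply/negP => Fu_gt0.
have ulthi : u i < hi i.
  rewrite lt_neqAle (andP (ubnd i)).2 andbT; apply/eqP => uhi.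
  move: Fu_gt0; apply/negP; rewrite -leNgt; apply: le_trans (Fhi i).
  by apply: Fmono => // j; case/andP: (ubnd j).
have : \forall t \near u i, 0 < F i (dfwith u i t).
  by apply: cvgr_gt (Fcont i u (u i)) _ _; rewrite dfwith_id.
move=> /nbhs_ballP[e /= e0 pos].
pose t := Num.min (u i + e / 2) (hi i).
have ut : u i < t by rewrite lt_min ulthi andbT; lra.
have te : t < u i + e.
  by rewrite gt_min; apply/orP; left; lra.
suff /leu/(_ i) : S (dfwith u i t) by rewrite dfwithin leNgt ut.
split=> j.
  case: dfwithP => // *; rewrite ge_min lexx orbT andbT.
  by case/andP: (ubnd i) => lou _; exact: le_trans lou (ltW ut).
have [<-|ij] := eqVneq i j.
  apply/ltW/pos; rewrite /ball/= distrC ger0_norm; lra.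
apply: le_trans (Fu j) _; apply: Fmono => [k|]; last by rewrite dfwithout.
by case: dfwithP => // *; exact: ltW.
Qed.
End Perron.

(** * Continuity and bounds of the truncated nonlinearity *)

(** The local Lipschitz hypothesis is a statement about pairs of nonnegative
points near a given pair; near the diagonal pair [(r, r)] with [r = max 0 s], and
with second component frozen at [r], it bounds the increments of [f] at [r]. *)
Lemma continuous_locally_lipschitz_pos (R : realType) (f : R -> R) :
  [locally [lipschitz f s | s in [set s : R | 0 <= s]]] ->
  continuous (fun s : R => f (Num.max 0 s)).
Proof.
move=> fL s; pose r := Num.max 0 s.
have cmax : continuous (fun t : R => Num.max 0 t).
  move=> t; apply: (@continuous_max R R (cst 0) id); first exact: cvg_cst.
  exact: cvg_id.
have r0 (t : R) : 0 <= Num.max 0 t by rewrite le_max lexx.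
have /= [M0 [_ LM]] := fL (r, r) (conj (r0 s) (r0 s)).
(* Any constant above [M0] is a local Lipschitz constant; the bound by [1] keeps
   it positive. *)
pose M := Num.max 1 (M0 + 1).
have M_gt0 : 0 < M by rewrite lt_max ltr01.
have /LM fLr : M0 < M by rewrite lt_max ltrDl ltr01 orbT.
have cpair : (Num.max 0 t, r) @[t --> s] --> (r, r).
  exact: (cvg_pair (cmax s) (cvg_cst r)).
have near_lip : \forall t \near s,
    `|f (Num.max 0 t) - f r| <= M * `|Num.max 0 t - r|.
  near=> t.
  have : (fun p : R * R => 0 <= p.1 /\ 0 <= p.2 ->
      `|f p.1 - f p.2| <= M * `|p.1 - p.2|) (Num.max 0 t, r).
    by near: t; exact: (cpair _ fLr).
  by apply; split; exact: r0.
apply/cvgrPdist_lt => e e0.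
have near_max : \forall t \near s, `|r - Num.max 0 t| < e / M.
  by have /cvgrPdist_lt := cmax s; apply; rewrite divr_gt0.
near=> t.
have lip : `|f (Num.max 0 t) - f r| <= M * `|Num.max 0 t - r| by near: t.
have tM : `|r - Num.max 0 t| < e / M by near: t.
rewrite distrC (le_lt_trans lip)// distrC mulrC.
by rewrite -ltr_pdivlMr.
Unshelve. all: by end_near. Qed.

Section Truncation.
Context {R : realType}.
Variables (lambda rho K hmax : R) (f : R -> R).
Hypothesis lambda_gt0 : 0 < lambda.
Hypothesis rhoK : rho < K / hmax.

Let g := truncation lambda rho K hmax f.

Lemma lambda_ceilingE : lambda * (K / (lambda * hmax)) = K / hmax.
Proof. by rewrite invfM mulrCA mulVKf ?gt_eqF. Qed.

Lemma floor_le_ceiling : rho / lambda <= K / (lambda * hmax).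
Proof. by rewrite ler_pdivrMr// mulrC lambda_ceilingE ltW. Qed.

(** The nested conditionals clamp [f s] between two ordered bounds; as a maximum
of a minimum, the clamp is visibly continuous and bounded. *)
Lemma truncationE s :
  g s = Num.max (rho / lambda) (Num.min (K / (lambda * hmax)) (f s)).
Proof.
rewrite /g /truncation; have := floor_le_ceiling.
set c := K / _; set d := rho / _ => dc.
case: ltP => [cf|fc]; first by rewrite max_r.
by case: ltP => [?|?]; rewrite ?max_l ?max_r// ltW.
Qed.

Lemma truncation_ge s : rho <= lambda * g s.
Proof. by rewrite truncationE -ler_pdivrMl// mulrC le_max lexx. Qed.

Lemma truncation_le s : lambda * g s <= K / hmax.
Proof.
rewrite -lambda_ceilingE ler_pM2l// truncationE ge_max floor_le_ceiling.
by rewrite ge_min lexx.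
Qed.

Lemma continuous_truncation (c : R -> R) :
  continuous (f \o c) -> continuous (g \o c).
Proof.
move=> fc.
have -> : g \o c =
    cst (rho / lambda) \max (cst (K / (lambda * hmax)) \min (f \o c)).
  by apply/funext => s /=; rewrite truncationE.
move=> s; apply: (@continuous_max R R); first exact: cvg_cst.
by apply: (@continuous_min R R); [exact: cvg_cst|exact: fc].
Qed.

End Truncation.

(** * Grid points, faces and neighbours *)

Section Grid.
Context {R : realType} {N : nat}.
Variables (a b : 'rV[R]_N) (m : 'I_N -> nat).
Hypothesis hab : forall i, a 0 i < b 0 i.
Hypothesis hm : forall i, (4 <= m i)%N.
Implicit Types (al : multi_index m) (u v : grid_function R m).

Local Notation h := (mesh a b m).
Local Notation x := (grid_point a b).

Definition on_face al i : bool := ~~ (0 < al i < (m i).-1)%N.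

Lemma pred_mE i : ((m i).-1%:R : R) = (m i)%:R - 1.
Proof. by rewrite -subn1 natrB//; exact: leq_trans (hm i). Qed.

Lemma mesh_gt0 i : 0 < h i.
Proof.
rewrite divr_gt0 ?subr_gt0//.
by rewrite ltr1n; exact: leq_trans (hm i).
Qed.

Lemma mesh_le_max i : h i <= mesh_max a b m.
Proof. exact: le_bigmax. Qed.

Lemma far_endE i : b 0 i = a 0 i + (m i).-1%:R * h i.
Proof.
rewrite pred_mE /mesh mulrC divfK; first by rewrite addrC subrK.
by rewrite gt_eqF// subr_gt0 ltr1n; exact: leq_trans (hm i).
Qed.

Lemma grid_point_near al i : (x al 0 i == a 0 i) = (al i == 0 :> nat)%N.
Proof.
rewrite mxE -subr_eq0 addrAC subrr add0r mulf_eq0 (gt_eqF (mesh_gt0 i)) orbF.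
by rewrite pnatr_eq0.
Qed.

Lemma grid_point_far al i : (x al 0 i == b 0 i) = (al i == (m i).-1 :> nat)%N.
Proof.
have h_neq0 : h i != 0 by rewrite gt_eqF// mesh_gt0.
by rewrite mxE far_endE (inj_eq (addrI _)) (inj_eq (mulIf h_neq0)) eqr_nat.
Qed.

Lemma on_faceE al i : on_face al i = ~~ (a 0 i < x al 0 i < b 0 i).
Proof.
rewrite mxE far_endE ltrDl ltrD2l ltr_pM2r ?mesh_gt0// ltr_nat.
by rewrite pmulr_lgt0 ?mesh_gt0// ltr0n.
Qed.

Lemma next_index_out i al j : j != i -> next_index i al j = al j.
Proof. by rewrite ffunE => /negbTE->. Qed.

Lemma prev_index_out i al j : j != i -> prev_index i al j = al j.
Proof. by rewrite ffunE => /negbTE->. Qed.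

Lemma next_index_in al i : ((al i).+1 < m i)%N ->
  next_index i al i = (al i).+1 :> nat.
Proof. by move=> lt; rewrite ffunE eqxx insubdK. Qed.

Lemma prev_index_in al i : prev_index i al i = (al i).-1 :> nat.
Proof.
by rewrite ffunE eqxx insubdK// -topredE/= (leq_ltn_trans (leq_pred _)).
Qed.

Lemma on_face_near_next al i :
  al i = 0 :> nat -> on_face (next_index i al) i = false.
Proof.
move=> al0; have m_gt2 : (2 < m i)%N by exact: leq_trans (hm i).
rewrite /on_face next_index_in al0/=; last exact: ltnW.
by rewrite ltn_predRL m_gt2.
Qed.

Lemma on_face_far_prev al i :
  al i = (m i).-1 :> nat -> on_face (prev_index i al) i = false.
Proof.
move=> alm; rewrite /on_face prev_index_in alm.
by have := hm i; case: (m i) => [|[|[|k]]] //= _; rewrite ltnSn.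
Qed.

(** * The discrete problem as a quasi-monotone system *)

(** Where several faces meet this is the sum of their normal difference
quotients, so that it is meaningful at every boundary grid point. *)
Definition normal_derivative u al : R := \sum_(i < N)
  (if x al 0 i == a 0 i then (u al - u (next_index i al)) / h i
   else if x al 0 i == b 0 i then (u al - u (prev_index i al)) / h i
   else 0).

(** The components of the gradient in the directions tangent to the face are
killed by the zeros of the normal. *)
Lemma dot_gradientE u al :
  dot (discrete_gradient a b u al) (outward_normal a b (x al)) =
  normal_derivative u al.
Proof.
apply: eq_bigr => i _; rewrite !mxE/=.
case: (_ == a 0 i); first by rewrite ltrN10 mulrN1 -mulNr opprB.
by case: (_ == b 0 i); rewrite ?ltr10 ?ltr01 ?mulr1 ?ltxx ?mulr0.
Qed.

(** The sign is chosen so that subsolutions have nonnegative residual. At edges and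
corners it imposes one more equation on [u], which makes the system uniform: one
equation per grid point. *)
Definition residual (q : R -> R) al u : R :=
  if [forall i, a 0 i < x al 0 i < b 0 i]
  then discrete_laplacian a b u al - u al
  else q (u al) - normal_derivative u al.

(** Each value of [u] at a neighbour of [al] appears with a coefficient
[1 / h_i ^ 2] or [1 / h_i]. *)
Lemma residual_quasi_monotone q : quasi_monotone (residual q).
Proof.
move=> al u v uv eq_al; rewrite /residual eq_al; case: ifP => _.
  rewrite lerD2r; apply: ler_sum => i _; rewrite eq_al.
  by rewrite ler_pM2r ?invr_gt0 ?exprn_gt0 ?mesh_gt0// lerD// lerD2r.
rewrite lerD2l lerN2; apply: ler_sum => i _; rewrite eq_al.
by do 2?case: ifP => // _; rewrite ler_pM2r ?invr_gt0 ?mesh_gt0// lerD2l lerN2.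
Qed.

Lemma continuous_dfwith_eval u al be :
  continuous (fun t : R => dfwith u al t be).
Proof.
have [<-|ne] := eqVneq al be.
  under eq_fun do rewrite dfwithin.
  by move=> t; exact: cvg_id.
under eq_fun do rewrite dfwithout//.
by move=> t; exact: cvg_cst.
Qed.

Lemma residual_own_continuous q : continuous q -> own_continuous (residual q).
Proof.
move=> qc al u t; have ev be := @continuous_dfwith_eval u al be t.
rewrite /residual; case: [forall i, _].
  apply: cvgB; last exact: ev.
  apply: (cvg_big (@add_continuous R)) => i _.
  apply: cvgM; last exact: cvg_cst.
  apply: cvgD; last exact: ev.
  apply: cvgB; first exact: ev.
  by apply: cvgM; [exact: cvg_cst|exact: ev].
apply: cvgB.
  by apply: continuous_comp; [exact: ev|exact: qc].
apply: (cvg_big (@add_continuous R)) => i _.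
by case: (_ == a 0 i); last case: (_ == b 0 i); try exact: cvg_cst;
  (apply: cvgM; [apply: cvgB; exact: ev|exact: cvg_cst]).
Qed.

Lemma residual_zero_ge0 q al : 0 <= q 0 -> 0 <= residual q al (fun=> 0).
Proof.
move=> q0; rewrite /residual; case: ifP => _.
  rewrite subr0; apply: sumr_ge0 => i _.
  by rewrite mulr0 subr0 addr0 mul0r.
rewrite subr_ge0 /normal_derivative big1// => i _.
by rewrite subrr mul0r !if_same.
Qed.

(** * The explicit supersolution *)

(** The second sum counts the faces through the grid point, so that the barrier
jumps by [K] across each of them. A jump of [K] adds at most [K / h_i ^ 2] to the
Laplacian at the adjacent point, for each of the two neighbours in direction [i];
the constant first sum dominates these contributions. *)
Definition barrier (K : R) al : R :=
  \sum_(i < N) 2 * K / h i ^+ 2 + K * \sum_(i < N) (on_face al i)%:R.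

Lemma barrier_diff K (al be : multi_index m) i :
  (forall j, j != i -> be j = al j) ->
  barrier K al - barrier K be =
  K * ((on_face al i)%:R - (on_face be i)%:R).
Proof.
move=> eq_be; rewrite /barrier opprD addrACA subrr add0r -mulrBr; congr (_ * _).
rewrite (bigD1 i)//= [X in _ - X](bigD1 i)//= opprD addrACA.
rewrite [X in _ + (_ - X)](eq_bigr (fun j => (on_face al j)%:R)) ?subrr ?addr0//.
by move=> j ji; rewrite /on_face eq_be.
Qed.

Lemma barrier_ge0 K al : 0 <= K -> 0 <= barrier K al.
Proof.
move=> K0; apply: addr_ge0; last first.
  by apply: mulr_ge0 => //; apply: sumr_ge0 => i _; exact: ler0n.
apply: sumr_ge0 => i _; apply: divr_ge0; first exact: mulr_ge0.
by rewrite exprn_ge0// ltW// mesh_gt0.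
Qed.

(** At an interior point each neighbour exceeds the barrier value by at most [K],
so the Laplacian is at most the constant part, which is the value of the barrier
there. At a boundary point every face through it contributes exactly
[K / h_i >= K / hmax] to the normal derivative, because with at least four grid
points per direction the inward neighbour has left that face. *)
Lemma barrier_residual_le0 K q al : 0 <= K ->
  (forall s, q s <= K / mesh_max a b m) -> residual q al (barrier K) <= 0.
Proof.
move=> K0 qK; rewrite /residual; case: ifPn => [/forallP inside|].
  have inF i : on_face al i = false by rewrite on_faceE inside.
  have step (be : multi_index m) i : (forall j, j != i -> be j = al j) ->
      barrier K be - barrier K al <= K.
    move=> /barrier_diff; rewrite inF => eqd.
    rewrite -opprB eqd sub0r mulrN opprK.
    by case: on_face; rewrite ?mulr1 ?mulr0.
  rewrite subr_le0.
  have -> : barrier K al = \sum_(i < N) 2 * K / h i ^+ 2.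
    by rewrite /barrier [X in _ + _ * X]big1 ?mulr0 ?addr0// => i _; rewrite inF.
  apply: ler_sum => i _.
  rewrite ler_pM2r ?invr_gt0 ?exprn_gt0 ?mesh_gt0//.
  have := step _ i (fun j => @next_index_out i al j).
  by have := step _ i (fun j => @prev_index_out i al j); lra.
rewrite negb_forall => /existsP[i0]; rewrite -on_faceE => onF.
have termE i : (if x al 0 i == a 0 i
      then (barrier K al - barrier K (next_index i al)) / h i
   else if x al 0 i == b 0 i
      then (barrier K al - barrier K (prev_index i al)) / h i
   else 0) = if on_face al i then K / h i else 0.
  rewrite grid_point_near grid_point_far.
  case: eqP => [al0|/eqP al0].
    rewrite (barrier_diff _ (fun j => @next_index_out i al j)).
    by rewrite on_face_near_next// /on_face al0/= subr0 mulr1.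
  case: eqP => [alm|/eqP alm].
    rewrite (barrier_diff _ (fun j => @prev_index_out i al j)).
    by rewrite on_face_far_prev// /on_face alm ltnn andbF/= subr0 mulr1.
  rewrite /on_face lt0n al0 ltn_neqAle alm/= -ltnS prednK ?ltn_ord//.
  exact: leq_trans (hm i).
rewrite subr_le0 (le_trans (qK _))// /normal_derivative.
rewrite (eq_bigr _ (fun i _ => termE i)) (bigD1 i0)//= onF.
apply: (@le_trans _ _ (K / h i0)).
  rewrite ler_wpM2l// lef_pV2 ?posrE ?mesh_gt0 ?mesh_le_max//.
  exact: lt_le_trans (mesh_gt0 i0) (mesh_le_max i0).
rewrite lerDl sumr_ge0// => i _; case: ifP => // _.
by rewrite divr_ge0// ltW// mesh_gt0.
Qed.

End Grid.

Theorem lemma3p1 (R : realType) (N : nat) (hN : (0 < N)%N)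
    (a b : 'rV[R]_N) (hab : forall i, a 0 i < b 0 i)
    (m : 'I_N -> nat) (hm : forall i, (4 <= m i)%N)
    (lambda : R) (hlambda : 0 < lambda)
    (f : R -> R) (hf0 : forall s, 0 <= s -> 0 <= f s)
    (hfLip : [locally [lipschitz f s | s in [set s : R | 0 <= s]]])
    (hfp : superlinear_subcritical N f)
    (rho K : R) (hrho : 0 < rho) (hK : 0 < K)
    (hrhoK : rho < K / mesh_max a b m) :
  exists u : grid_function R m,
    [/\ forall alpha, 0 <= u alpha,
        forall alpha, rectangle a b (grid_point a b alpha) ->
          - discrete_laplacian a b u alpha + u alpha = 0 &
        forall alpha, smooth_boundary a b (grid_point a b alpha) ->
          dot (discrete_gradient a b u alpha) (outward_normal a b (grid_point a b alpha))
            - lambda * truncation lambda rho K (mesh_max a b m) f (u alpha) = 0].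
Proof.
pose q s := lambda * truncation lambda rho K (mesh_max a b m) f (Num.max 0 s).
have q_cont : continuous q.
  move=> s; apply: cvgM; first exact: cvg_cst.
  apply: (continuous_truncation hlambda hrhoK).
  exact: continuous_locally_lipschitz_pos.
have q_le s : q s <= K / mesh_max a b m by exact: truncation_le.
have q0 : 0 <= q 0.
  by apply: (@le_trans _ _ rho); [exact: ltW|exact: truncation_ge].
have [u [u_bnd u_sol]] := quasi_monotone_solution
  (residual_quasi_monotone hab hm q)
  (residual_own_continuous (a := a) (b := b) (m := m) q_cont)
  (fun al => barrier_ge0 hab hm al (ltW hK))
  (fun al => residual_zero_ge0 a b al q0)
  (fun al => barrier_residual_le0 hab hm al (ltW hK) q_le).
have u_ge0 al : 0 <= u al by case/andP: (u_bnd al).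
exists u; split=> // al.
  move=> /forallP inside; have := u_sol al; rewrite /residual inside => sol.
  by rewrite addrC -opprB sol oppr0.
move=> [_ [i [on_i _]]].
have out : [forall j, a 0 j < grid_point a b al 0 j < b 0 j] = false.
  apply/negbTE; rewrite negb_forall; apply/existsP; exists i.
  by case: on_i => ->; rewrite ltxx ?andbF.
have := u_sol al; rewrite /residual out => sol.
by rewrite dot_gradientE -[RHS]oppr0 -sol opprB /q max_r.
Qed.
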